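(* Let $R\subset\mathbb{R}^d\setminus\{0\}$ be a finite reduced set. Then the following are equivalent: (i) $R$ is a root system; (ii) all semi-stars of $R$ are congruent.
   Context: A set $R\subset\mathbb{R}^d\setminus\{0\}$ is reduced if $\mathrm{span}\{r\}\cap R=\{-r,r\}$ for all $r\in R$ (in particular $R=-R$). A root system is a finite set $R\subset\mathbb{R}^d\setminus\{0\}$ with $T_rR=R$ for all $r\in R$, where $T_r=\mathrm{Id}-2rr^{\top}/\|r\|^2$ is the reflection on the hyperplane $r^\perp$ (no crystallographic or reducedness condition is required). A semi-star of a finite centrally symmetric set $R\subset\mathbb{R}^d\setminus\{0\}$ is a subset $S\subseteq R$ that contains exactly half the elements of $R$ and is the intersection of $R$ with a half-space; equivalently, $S=\{r\in R\mid\langle r,c\rangle>0\}$ for some $c\in\mathbb{R}^d\setminus\{0\}$ that is non-orthogonal to every $r\in R$. Two semi-stars $S,S'$ are congruent if $TS=S'$ for some $T\in\mathrm{O}(\mathbb{R}^d)$. *)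

(* Defs.v *)
From HB Require Import structures.
From mathcomp Require Import all_boot all_order all_algebra.
From mathcomp Require Import finmap.
From mathcomp Require Import reals.

Set Implicit Arguments.
Unset Strict Implicit.
Unset Printing Implicit Defensive.
Import Order.TTheory GRing.Theory Num.Theory.

Local Open Scope fset_scope.
Local Open Scope ring_scope.

Section Defs.
Context {R : realType} {d : nat}.
Implicit Types (x y r c : 'cV[R]_d) (X S : {fset 'cV[R]_d}) (T : 'M[R]_d).

(* The sup norm that the library puts on matrices is not the Euclidean norm;
   the squared Euclidean norm of x is [dot x x]. *)
Definition dot x y : R := (x^T *m y) 0 0.

Definition reduced X : Prop :=
  forall r, r \in X -> [fset x in X | x \in <[r]>%VS] = [fset - r; r].

Definition mximage T X : {fset 'cV[R]_d} := [fset T *m x | x in X].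

Definition reflection r : 'M[R]_d := 1%:M - (2 / dot r r) *: (r *m r^T).

Definition root_system X : Prop :=
  0 \notin X /\ forall r, r \in X -> mximage (reflection r) X = X.

(* The half-space may be affine, and is closed or open according to [cl];
   see [semi_starP] for the description by a generic linear functional. *)
Definition half_space c (b : R) (cl : bool) : pred 'cV[R]_d :=
  fun x => b < dot x c ?<= if cl.

Definition semi_star X S : Prop :=
  (2 * #|` S| = #|` X|)%N /\
  exists (c : 'cV[R]_d) (b : R) (cl : bool),
    c != 0 /\ S = [fset x in X | half_space c b cl x].

Definition orthogonal T : Prop := T^T *m T = 1%:M.

Definition congruent S S' : Prop :=
  exists T : 'M[R]_d, orthogonal T /\ mximage T S = S'.

Lemma dotNl x y : dot (- x) y = - dot x y.
Proof. by rewrite /dot linearN mulNmx mxE. Qed.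

Lemma semi_starP X S : (forall x, x \in X -> - x \in X) ->
  semi_star X S <->
  exists c : 'cV[R]_d, [/\ c != 0, (forall x, x \in X -> dot x c != 0) &
    S = [fset x in X | 0 < dot x c]].
Proof.
move=> symX.
have cardX c : #|` X| = (2 * #|` [fset x in X | (0 < dot x c)%R]|
    + #|` [fset x in X | dot x c == 0%R]|)%N.
  set P := [fset x in X | 0 < dot x c]; set Z := [fset x in X | dot x c == 0].
  pose N := [fset x in X | dot x c < 0].
  have -> : X = P `|` N `|` Z.
    apply/fsetP => x; rewrite !inE /=; case: (x \in X) => //=.
    by case: (ltrgtP (dot x c) 0).
  have NE : N = [fset - x | x in P].
    apply/fsetP => x; apply/idP/imfsetP => /=.
      rewrite !inE /= => /andP[xX x0]; exists (- x); last by rewrite opprK.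
      by rewrite !inE /= symX //= dotNl oppr_gt0.
    case=> y; rewrite !inE /= => /andP[yX y0] ->.
    by rewrite symX //= dotNl oppr_lt0.
  have cN : #|` N| = #|` P| by rewrite NE card_imfset //=; exact: oppr_inj.
  have PN0 : P `&` N = fset0.
    apply/fsetP => x; rewrite !inE /=; case: (x \in X) => //=.
    by case: (ltrgtP (dot x c) 0).
  have PNZ0 : (P `|` N) `&` Z = fset0.
    apply/fsetP => x; rewrite !inE /=; case: (x \in X) => //=.
    by case: (ltrgtP (dot x c) 0).
  by rewrite cardfsU PNZ0 cardfs0 subn0 cardfsU PN0 cardfs0 subn0 cN mul2n addnn.
have noZ c : #|` [fset x in X | dot x c == 0%R]| = 0%N ->
    forall x, x \in X -> dot x c != 0.
  move=> /eqP; rewrite cardfs_eq0 => /eqP Z0 x xX; apply/negP => x0.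
  by have := in_fset0 x; rewrite -Z0 !inE /= xX x0.
split=> [[cS [c [b [cl [c0 SE]]]]]|[c [c0 cX SE]]]; last first.
  split; last by exists c, 0, false.
  rewrite (cardX c) -SE.
  have -> : [fset x in X | dot x c == 0] = fset0.
    apply/fsetP => x; rewrite !inE /=; apply/negP => /andP[xX].
    by rewrite (negPf (cX _ xX)).
  by rewrite cardfs0 addn0.
exists c; set P := [fset x in X | 0 < dot x c].
have := cardX c; rewrite -/P; set Z := [fset x in X | dot x c == 0] => cX.
have [bp|bn] : (forall x, half_space c b cl x -> 0 < dot x c) \/
               (forall x, 0 <= dot x c -> half_space c b cl x).
- rewrite /half_space; case: cl {SE} => /=; have [b0|b0] := ltrP 0 b.
  + by left=> x; apply: lt_le_trans.
  + by right=> x; apply: le_trans.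
  + by left=> x; apply: lt_trans.
  + have [->|bN] := eqVneq b 0; first by left.
    by right=> x; apply: lt_le_trans; rewrite lt_neqAle bN.
- have SP : S `<=` P.
    apply/fsubsetP => x; rewrite SE !inE /= => /andP[-> /=]; exact: bp.
  have := fsubset_leq_card SP; rewrite -(leq_pmul2l (isT : 0 < 2)%N) cS cX.
  rewrite -{2}[(2 * _)%N]addn0 leq_add2l leqn0 => /eqP Z0.
  split=> //; first exact: noZ.
  apply/eqP; rewrite eqEfcard SP /= -(leq_pmul2l (isT : 0 < 2)%N) cS cX.
  by rewrite Z0 addn0.
- have PS : P `|` Z `<=` S.
    apply/fsubsetP => x; rewrite SE !inE /= => /orP[]/andP[-> /=] h.
      by apply: bn; exact: ltW.
    by apply: bn; rewrite (eqP h).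
  have PZ0 : P `&` Z = fset0.
    apply/fsetP => x; rewrite !inE /=; case: (x \in X) => //=.
    by case: (ltrgtP (dot x c) 0).
  have := fsubset_leq_card PS; rewrite cardfsU PZ0 cardfs0 subn0.
  rewrite -(leq_pmul2l (isT : 0 < 2)%N) cS cX mulnDr leq_add2l mul2n -addnn.
  rewrite -{3}[#|` Z|]addn0 leq_add2l leqn0 => /eqP Z0.
  split=> //; first exact: noZ.
  apply/esym/eqP; rewrite eqEfcard (fsubset_trans (fsubsetUl P Z) PS) /=.
  by rewrite -(leq_pmul2l (isT : 0 < 2)%N) cS cX Z0 addn0.
Qed.

End Defs.

(* Main.v *)
Require Import Defs.
From HB Require Import structures.
From mathcomp Require Import all_boot all_order all_algebra.
From mathcomp Require Import finmap.
From mathcomp Require Import reals.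
From mathcomp Require Import boolp complex ring lra.
(* [orthogonal] must denote orthogonal matrices, not orthogonal subspaces. *)
Import Defs.
Import Order.TTheory GRing.Theory Num.Theory.
Local Open Scope fset_scope.
Local Open Scope ring_scope.

(** Suppose that [X] is a root system, and let [c] and [c'] be normals of two
    semi-stars. Among the semi-stars congruent to that of [c], one has a sum of
    elements whose projection on [c'] is largest. It is the semi-star of [c'],
    since reflecting at one of its elements on the wrong side of [c'] would make
    the projection larger ([congruent_positive]).

    Conversely, suppose that all semi-stars are congruent. An orthogonal map
    between semi-stars preserves lengths, so for each length it maps the sum of
    the elements of that length in one semi-star to the same sum in the other, and
    the scalar products of these sums are the same for all semi-stars
    ([half_sum_invariant]). Comparing semi-stars that differ only in the sign
    of some [r] in [X] shows that, for each length, the sum of the other elements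
    of that length in the semi-star is orthogonal to [r] ([wall_balanced]).
    Comparing two such conditions whose normals are close to a vector orthogonal
    to a plane shows that the same holds for the part of [X] in that
    plane ([flat_balanced]).

    It remains to study, in the plane spanned by two elements of [X], the set [A]
    of elements of [X] of one given length. Its balance conditions say that the
    centrally symmetric polygon with edges parallel and proportional to
    the elements of [A] has all its vertices on a circle about the origin. Its
    edges have equal length, so it is regular: one rotation maps each element
    of [A] to the next one. Balance at the direction of an element of [X] of another
    length says that this direction bisects two consecutive elements of [A]. In
    either case the reflection at that direction preserves [A]
    ([conj_opp_stable]), so every reflection at an element of [X] maps each
    element of [X] into [X]. Treating each length separately is what makes the
    reflections preserve [X] itself and not only the set of its directions. *)

Set Implicit Arguments.
Unset Strict Implicit.
Unset Printing Implicit Defensive.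

(** * Finite sets *)

Lemma fset_argmax (R : realDomainType) (K : choiceType) (A : {fset K})
    (P : K -> Prop) (f : K -> R) :
  (exists2 x, x \in A & P x) ->
  exists x, [/\ x \in A, P x & forall y, y \in A -> P y -> f y <= f x].
Proof.
case=> x0 x0A Px0; pose B := [fset x in A | `[< P x >]].
have x0B : x0 \in B by rewrite !inE /= x0A; apply/asboolP.
pose i := [arg max_(i > [` x0B]) f (val i)]%O.
have /andP[iA /asboolP Pi] : (val i \in A) && `[< P (val i) >].
  by have := valP i; rewrite !inE.
exists (val i); split=> // y yA Py.
have yB : y \in B by rewrite !inE /= yA; apply/asboolP.
by rewrite /i; case: arg_maxP => // j _ /(_ [` yB] isT).
Qed.

Lemma sum_fset_opp (V : zmodType) (A : {fset V}) (P : pred V) :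
  (forall x, x \in A -> - x \in A) ->
  \sum_(x <- A | P (- x)) x = - \sum_(x <- A | P x) x.
Proof.
move=> A_opp; rewrite -sumrN.
have AE : A = [fset - x | x in A].
  apply/fsetP => x; apply/idP/imfsetP => [xA|[y /= yA ->]]; last exact: A_opp.
  by exists (- x); rewrite /= ?A_opp ?opprK.
rewrite {1}AE big_mkcond big_imfset /=; last by move=> x y _ _; exact: oppr_inj.
by rewrite -big_mkcond; apply: eq_bigl => x; rewrite opprK.
Qed.

(** * Balanced sets of complex numbers of equal modulus *)

Section Plane.
Variable R : rcfType.
Implicit Types (a b s n x y z : R[i]) (l : R).

(** The real and imaginary parts of the product of [y] with the conjugate of [x]:
    for [x] and [y] on a common circle they are, up to a positive factor, the
    cosine and the sine of the angle from [x] to [y]. *)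
Definition cdot x y : R :=
  complex.Re x * complex.Re y + complex.Im x * complex.Im y.
Definition cdet x y : R :=
  complex.Re x * complex.Im y - complex.Im x * complex.Re y.

Lemma cdotDr a x y : cdot a (x + y) = cdot a x + cdot a y.
Proof. by case: a x y => ? ? [? ?] [? ?]; rewrite /cdot /=; ring. Qed.

Lemma cdetDr a x y : cdet a (x + y) = cdet a x + cdet a y.
Proof. by case: a x y => ? ? [? ?] [? ?]; rewrite /cdet /=; ring. Qed.

Lemma cdotNr a x : cdot a (- x) = - cdot a x.
Proof. by case: a x => ? ? [? ?]; rewrite /cdot /=; ring. Qed.

Lemma cdetNr a x : cdet a (- x) = - cdet a x.
Proof. by case: a x => ? ? [? ?]; rewrite /cdet /=; ring. Qed.

Lemma cdetNl a x : cdet (- a) x = - cdet a x.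
Proof. by case: a x => ? ? [? ?]; rewrite /cdet /=; ring. Qed.

Lemma cdet_sumr (I : Type) (r : seq I) (P : pred I) (F : I -> R[i]) a :
  cdet a (\sum_(i <- r | P i) F i) = \sum_(i <- r | P i) cdet a (F i).
Proof.
by apply: (big_morph _ (cdetDr a)); rewrite /cdet /= !mulr0 subr0.
Qed.

Lemma cdotC a b : cdot a b = cdot b a.
Proof. by case: a b => ? ? [? ?]; rewrite /cdot /=; ring. Qed.

Lemma cdetC a b : cdet a b = - cdet b a.
Proof. by case: a b => ? ? [? ?]; rewrite /cdet /=; ring. Qed.

(** The chord from [s] to [n] is a quarter turn away from their bisector
    [n + s], so for points of one circle the order of the projections on [b]
    translates into a sign of [cdet]. *)
Lemma cdet_cdot_chord l b n s : cdot n n = l -> cdot s s = l ->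
  cdet n s * (cdet b s + cdet b n) = (cdot b n - cdot b s) * (l + cdot n s).
Proof.
case: b n s => b1 b2 [n1 n2] [s1 s2]; rewrite /cdot /cdet /=.
move=> h1 h2.
have E : s2 * s2 - (n1 * n1 + n2 * n2 - s1 * s1) = 0 by rewrite h1 -h2; ring.
(* The two sides agree up to a multiple of the difference of the norms. *)
transitivity (((b1 * n1 + b2 * n2) - (b1 * s1 + b2 * s2)) *
    (n1 * n1 + n2 * n2 + (n1 * s1 + n2 * s2)) +
  (s2 * s2 - (n1 * n1 + n2 * n2 - s1 * s1)) * (b1 * n1 + b2 * n2)); first by ring.
by rewrite E -h1; ring.
Qed.

Lemma cdot_lt l n s : 0 < l -> cdot n n = l -> cdot s s = l -> s != n ->
  cdot n s < l.
Proof.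
case: n s => n1 n2 [s1 s2]; rewrite /cdot /= => l0 h1 h2 ne.
have h : 0 <= (n1 - s1)^+2 + (n2 - s2)^+2 by rewrite addr_ge0 ?sqr_ge0.
have h' : (n1 - s1)^+2 + (n2 - s2)^+2 != 0.
  apply: contraNneq ne => /eqP; rewrite paddr_eq0 ?sqr_ge0 // !sqrf_eq0.
  by rewrite !subr_eq0 => /andP[/eqP-> /eqP->].
have : 0 < (n1 - s1)^+2 + (n2 - s2)^+2 by rewrite lt_neqAle eq_sym h' h.
nra.
Qed.

Lemma cdot_cdet x y : cdot x y ^+ 2 + cdet x y ^+ 2 = cdot x x * cdot y y.
Proof. by case: x y => ? ? [? ?]; rewrite /cdot /cdet /=; ring. Qed.

Lemma cdot_cdetK b x :
  (cdot b x +i* cdet b x)%C * b = (cdot b b +i* 0)%C * x.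
Proof.
case: b x => ? ? [? ?]; apply/eqP; rewrite eq_complex /cdot /cdet /=.
by apply/andP; split; apply/eqP; ring.
Qed.

Lemma cdot_cdet_inj b x y : 0 < cdot b b ->
  cdot b x = cdot b y -> cdet b x = cdet b y -> x = y.
Proof.
move=> b0 hdot hdet; have := cdot_cdetK b x; rewrite hdot hdet cdot_cdetK => E.
by apply/esym/(mulfI _ E); rewrite eq_complex /= negb_and gt_eqF.
Qed.

Lemma cdetxx b : cdet b b = 0.
Proof. by rewrite /cdet mulrC subrr. Qed.

(** The angle from [b] to [x] lies in the half-open interval from 0, excluded, to
    pi, included. Including one end makes exactly one of [x] and [- x] satisfy
    it, whether or not [x] is parallel to [b] (see [turnN]). *)
Definition turn b x := (0 < cdet b x) || ((cdet b x == 0) && (cdot b x < 0)).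

Lemma turn_ge0 b x : turn b x -> 0 <= cdet b x.
Proof. by case/orP=> [/ltW|/andP[/eqP->]]. Qed.

Lemma turnN b x : 0 < cdot b b -> 0 < cdot x x -> turn b (- x) = ~~ turn b x.
Proof.
move=> b0 x0; rewrite /turn cdetNr cdotNr oppr_gt0 oppr_eq0 oppr_lt0.
case: (ltgtP (cdet b x) 0) => //= d0; case: (ltgtP (cdot b x) 0) => //= e0.
by have := cdot_cdet b x; rewrite d0 e0 expr0n /= addr0 => /esym/eqP;
  rewrite gt_eqF ?mulr_gt0.
Qed.

(** On a half circle the angle is decreasing in the projection on [b]. *)
Lemma turn_cdet l b n s : 0 < l -> 0 < cdot b b -> cdot n n = l -> cdot s s = l ->
  turn b n -> turn b s -> s != n -> cdot b s <= cdot b n -> 0 < cdet n s.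
Proof.
move=> l0 b0 hn hs tn ts sn le_sn.
have dn := turn_ge0 tn; have ds := turn_ge0 ts.
have sNn : s != - n.
  by apply: contraTneq ts => ->; rewrite turnN ?tn ?hn.
have hNn : cdot (- n) (- n) = l by rewrite cdotNr cdotC cdotNr opprK.
have := cdot_lt l0 hNn hs sNn; rewrite cdotC cdotNr cdotC => dot_ns.
have lt_sn : cdot b s < cdot b n.
  rewrite lt_neqAle le_sn andbT; apply: contraNneq sn => E.
  apply/eqP/(cdot_cdet_inj b0 E)/eqP; rewrite -(eqrXn2 (n := 2)) //.
  rewrite -(inj_eq (addrI (cdot b s ^+ 2))) {2}E !cdot_cdet hn hs eqxx //.
have chord := cdet_cdot_chord b hn hs.
have : 0 < (cdot b n - cdot b s) * (l + cdot n s).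
  by rewrite mulr_gt0 ?subr_gt0 //; lra.
rewrite -chord => prod_gt0; rewrite ltNge; apply/negP => dns.
by move: prod_gt0; rewrite ltNge mulr_le0_ge0 // addr_ge0.
Qed.

Section Arrangement.
Variables (A : {fset R[i]}) (l : R).
Hypothesis l_gt0 : 0 < l.
Hypothesis A_norm : forall x, x \in A -> cdot x x = l.
Hypothesis A_opp : forall x, x \in A -> - x \in A.

Definition above b : R[i] := \sum_(x <- A | 0 < cdet b x) x.

(** A vertex of the polygon that is the Minkowski sum of the segments from [- x] to
    [x], one for each pair of opposite elements of [A]. *)
Definition vertex b := above b + b.

(** The first element of [A] at a positive angle from [b]. *)
Definition next b n := [/\ n \in A, turn b n &
  forall x, x \in A -> turn b x -> cdot b x <= cdot b n].

Let A_gt0 x : x \in A -> 0 < cdot x x.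
Proof. by move/A_norm->. Qed.

Lemma next_exists b a : 0 < cdot b b -> a \in A -> exists n, next b n.
Proof.
move=> b0 aA; suff aT : exists2 x, x \in A & turn b x.
  by have [n [nA tn nmax]] := fset_argmax (cdot b) aT; exists n.
have [ta|/negPf ta] := boolP (turn b a); first by exists a.
by exists (- a); rewrite ?A_opp // turnN ?(A_gt0 aA) ?ta.
Qed.

(** The open half-plane that starts at [n], completed by [n], contains the same
    elements of [A] as the half-plane that starts at [b], because no element
    lies strictly between [b] and [n]. *)
Lemma vertex_next b n : 0 < cdot b b -> next b n ->
  vertex n = \sum_(x <- A | turn b x) x.
Proof.
move=> b0 [nA tn nmax].
have turn_next x : x \in A -> turn b x -> (x == n) || (0 < cdet n x).
  move=> xA tx; have [//|xn] := eqVneq x n.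
  exact: (turn_cdet l_gt0 b0 (A_norm nA) (A_norm xA)) (nmax _ _ _).
transitivity (\sum_(x <- A | (x == n) || (0 < cdet n x)) x).
  rewrite /vertex /above big_mkcond [RHS]big_mkcond /= [RHS](big_fsetD1 n) //=.
  rewrite (big_fsetD1 n) //= eqxx cdetxx ltxx add0r addrC.
  congr (_ + _); apply: eq_big_seq => x.
  by rewrite !inE => /andP[/negPf-> _].
rewrite big_seq_cond [RHS]big_seq_cond; apply: eq_bigl => x.
have [xA|//] := boolP (x \in A); rewrite /=.
apply/idP/idP; last exact: turn_next.
case/orP=> [/eqP->//|dx]; rewrite -[turn b x]negbK -turnN ?(A_gt0 xA) //.
apply/negP => /(turn_next _ (A_opp xA)); rewrite cdetNr oppr_gt0.
case/orP=> [/eqP nE|]; last by rewrite ltNge ltW.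
by rewrite -nE cdetNl cdetxx oppr0 ltxx in dx.
Qed.

Lemma vertexN b : vertex (- b) = - vertex b.
Proof.
rewrite /vertex opprD -sum_fset_opp //; congr (_ + _); apply: eq_bigl => x.
by rewrite cdetNl cdetNr.
Qed.

Lemma turnE b x : b \in A -> x \in A -> turn b x = (x == - b) || (0 < cdet b x).
Proof.
move=> bA xA; rewrite /turn orbC; congr (_ || _).
apply/andP/eqP => [[/eqP d0 e0]|->]; last first.
  by rewrite cdetNr cdotNr cdetxx oppr0 oppr_lt0 A_gt0.
apply: (cdot_cdet_inj (A_gt0 bA)); last by rewrite cdetNr cdetxx d0 oppr0.
have := cdot_cdet b x; rewrite d0 cdotNr !A_norm // expr0n addr0 -expr2 => /eqP.
rewrite eqf_sqr => /orP[]/eqP // E; move: e0 l_gt0; rewrite E => ? ?; lra.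
Qed.

(** When [b] is in [A], the polygon has an edge along [b]. *)
Lemma vertex_next_in b n : b \in A -> next b n -> vertex n = vertex b - b - b.
Proof.
move=> bA /(vertex_next (A_gt0 bA)) ->; rewrite /vertex addrK /above.
rewrite big_mkcond [in RHS]big_mkcond /=.
rewrite !(big_fsetD1 _ (A_opp bA)) /= turnE ?A_opp // eqxx cdetNr cdetxx oppr0 ltxx.
rewrite add0r addrC; congr (_ + _); apply: eq_big_seq => x.
by rewrite !inE => /andP[/negPf xb xA]; rewrite turnE // xb.
Qed.

(** The successor of [b] does not overshoot [s] and is nearer to it: the
    termination argument for walking through [A] from one element to the next. *)
Lemma next_closer b n s : b \in A -> next b n -> s \in A -> s != b ->
  0 <= cdet b s -> 0 <= cdet n s /\ cdot b s < cdot n s.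
Proof.
move=> bA [nA tn nmax] sA sb ds.
have ts : turn b s.
  rewrite -[turn b s]negbK -turnN ?A_gt0 // turnE ?A_opp //.
  by rewrite (inj_eq oppr_inj) (negPf sb) cdetNr oppr_gt0 -leNgt.
have [->|sn] := eqVneq s n.
  rewrite cdetxx (A_norm nA); split=> //.
  apply: (cdot_lt l_gt0 (A_norm bA) (A_norm nA)).
  by apply: contraTneq tn => ->; rewrite /turn cdetxx ltxx eqxx /= -leNgt ltW ?A_gt0.
have dns : 0 < cdet n s.
  exact: (turn_cdet l_gt0 (A_gt0 bA) (A_norm nA) (A_norm sA)) (nmax _ _ _).
split; first exact: ltW.
have nNb : n != - b.
  apply: contraNneq sn => nE; have := nmax _ sA ts; rewrite nE cdotNr (A_norm bA).
  apply: contraTT => sNb; rewrite -ltNge.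
  have := cdot_lt l_gt0 (A_norm (A_opp bA)) (A_norm sA) sNb.
  by rewrite cdotC cdotNr cdotC => ?; lra.
have dbn : 0 < cdet b n by move: tn; rewrite turnE // (negPf nNb).
have := cdet_cdot_chord s (A_norm bA) (A_norm nA).
have := cdot_lt l_gt0 (A_norm (A_opp bA)) (A_norm nA) nNb.
rewrite cdotC cdotNr cdotC (cdetC s n) (cdetC s b) (cdotC s b) (cdotC s n).
move=> h1 h2; have h3 : 0 < cdet n s + cdet b s by lra.
have h4 : 0 < cdet b n * (cdet n s + cdet b s) by rewrite mulr_gt0.
have h5 : 0 < l + cdot b n by lra.
rewrite ltNge; apply/negP => h6.
have : (cdot n s - cdot b s) * (l + cdot b n) <= 0.
  by rewrite mulr_le0_ge0 ?subr_le0 // ltW.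
lra.
Qed.

(** Walking from [a] or [- a] by successors reaches every [s]: otherwise take, among
    the elements with [P] at most half a turn before [s], the one nearest to [s];
    its successor is nearer. *)
Lemma next_transitive (P : R[i] -> Prop) a : a \in A -> P a ->
  (forall b, b \in A -> P b -> P (- b)) ->
  (forall b n, b \in A -> P b -> next b n -> P n) ->
  forall s, s \in A -> P s.
Proof.
move=> aA Pa PN Pnext s sA.
have [|b [bA [Pb db] bmax]] := @fset_argmax _ _ A
    (fun b => P b /\ 0 <= cdet b s) (fun b => cdot b s).
  have [d|/ltW d] := lerP 0 (cdet a s); first by exists a.
  exists (- a); rewrite ?A_opp //; split; first exact: PN.
  by rewrite cdetNl oppr_ge0.
have [->//|sb] := eqVneq s b.
have [n nx] := next_exists (A_gt0 bA) bA; have [dn lt] := next_closer bA nx sA sb db.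
have [nA _ _] := nx.
by have := bmax n nA (conj (Pnext _ _ bA Pb nx) dn); rewrite leNgt lt.
Qed.

(** Balance at [b] says that the two ends of the edge along [b] are at the same
    distance from the origin. *)
Hypothesis A_balanced : forall b, b \in A -> cdot b (above b) = 0.

Lemma cdot_vertex b : b \in A -> cdot b (vertex b) = l.
Proof. by move=> bA; rewrite cdotDr A_balanced // A_norm // add0r. Qed.

Lemma cdet_vertex_ge0 b : 0 <= cdet b (vertex b).
Proof.
rewrite cdetDr cdetxx addr0 cdet_sumr; apply: sumr_ge0 => x; exact: ltW.
Qed.

(** Up to scale, [cdet b (vertex b)] is the distance from the origin to the edge
    along [b]. Consecutive edges are chords of equal length of one circle. *)
Lemma cdet_vertex_next b n : b \in A -> next b n ->
  cdet n (vertex n) = cdet b (vertex b).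
Proof.
move=> bA nx; have [nA _ _] := nx; apply/eqP.
rewrite -(eqrXn2 (n := 2)) ?cdet_vertex_ge0 //.
have E c : c \in A -> cdet c (vertex c) ^+ 2 = l * cdot (vertex c) (vertex c) - l ^+ 2.
  by move=> cA; rewrite -{1}(A_norm cA) -cdot_cdet cdot_vertex //; ring.
rewrite !E // (vertex_next_in bA nx).
have cdotB v : cdot (v - b - b) (v - b - b) = cdot v v - 4 * cdot b v + 4 * cdot b b.
  by case: (v) (b) => ? ? [? ?]; rewrite /cdot /=; ring.
by rewrite cdotB cdot_vertex // (A_norm bA); apply/eqP; ring.
Qed.

Lemma cdet_vertex_const a b : a \in A -> b \in A ->
  cdet b (vertex b) = cdet a (vertex a).
Proof.
move=> aA bA; apply: (next_transitive aA (P := fun b => cdet b (vertex b) = _)) bA => //.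
  by move=> {}b bA <-; rewrite vertexN cdetNl cdetNr opprK.
by move=> {}b n bA <-; exact: cdet_vertex_next.
Qed.

(** Balance at the real axis, which may or may not meet [A]. *)
Hypothesis A_balanced1 : complex.Re (above 1) = 0.

(** With the constant [m = l +i* K], where [K] is the value of [cdet b (vertex b)],
    one has [l * vertex b = m * b] for all [b] in [A]; the edge relation then
    says that the successor of [b] is [q * b] for the fixed rotation
    [q = - m^* / m]. Reflection at the imaginary axis conjugates [q] to its inverse,
    so the elements of [A] with reflection in [A] are closed under successors;
    by [next_transitive] it suffices to find one. *)
Lemma conj_opp_stable z : z \in A -> - (z^*)%C \in A.
Proof.
move=> zA; set K := cdet z (vertex z); pose m : R[i] := (l +i* K)%C.
have mc_neq0 : (m^*)%C != 0 by rewrite eq_complex /= negb_and gt_eqF.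
have vertexE b : b \in A -> m * b = (l +i* 0)%C * vertex b.
  move=> bA; rewrite -[in RHS](A_norm bA) -cdot_cdetK cdot_vertex //.
  by rewrite (cdet_vertex_const zA bA).
have nextE b n : b \in A -> next b n -> m * n = - (m^*)%C * b.
  move=> bA nx; have [nA _ _] := nx.
  rewrite vertexE // (vertex_next_in bA nx) !mulrBr -vertexE // /m.
  case: (b) => b1 b2; apply/eqP; rewrite eq_complex /=.
  by apply/andP; split; apply/eqP; ring.
(* Having a predecessor is inherited by opposites and by successors. *)
have prev s : s \in A -> exists2 p, p \in A & m * s = - (m^*)%C * p.
  have [n nx] := next_exists (A_gt0 zA) zA; have [nA _ _] := nx.
  pose P s := exists2 p, p \in A & m * s = - (m^*)%C * p.
  apply: (next_transitive (P := P) nA) => [|b bA [p pA E]|b n' bA _ nx'].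
  - by exists z => //; exact: nextE.
  - by exists (- p); rewrite ?A_opp // !mulrN E.
  - by exists b => //; exact: nextE.
have b1 : 0 < cdot (1 : R[i]) 1 by rewrite /cdot /= mulr0 addr0 mulr1.
have cdet1 x : cdet 1 x = complex.Im x by rewrite /cdet /= mul0r subr0 mul1r.
have [a aA TaA] : exists2 a, a \in A & - (a^*)%C \in A.
  (* A real element is sent to its opposite. Otherwise the real axis separates
     two consecutive elements, which are exchanged up to sign. *)
  have [[a aA a0]|noreal] := pselect (exists2 a, a \in A & complex.Im a = 0).
    exists a => //; suff -> : (a^*)%C = a by exact: A_opp.
    by case: (a) a0 => ? ? /= ->; rewrite oppr0.
  have [a nx] := next_exists b1 zA; have [aA _ _] := nx; exists a => //.
  have Re0 : complex.Re (vertex a) = 0.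
    rewrite (vertex_next b1 nx) -[RHS]A_balanced1 /above; congr complex.Re.
    rewrite big_seq_cond [RHS]big_seq_cond; apply: eq_bigl => x.
    have [xA|//] := boolP (x \in A); rewrite /turn /= orbC.
    case: eqP => //; rewrite cdet1 => x0; case: noreal; by exists x.
  have [p pA E] := prev _ aA; suff -> : - (a^*)%C = - p by exact: A_opp.
  congr (- _); apply: (mulfI mc_neq0); apply: oppr_inj.
  rewrite -mulNr -mulNr -E vertexE //.
  have : ((m * a)^*)%C = (((l +i* 0) * vertex a)^*)%C by rewrite vertexE.
  rewrite rmorphM /= mulNr => ->; case: (vertex a) Re0 => v1 v2 /= ->.
  apply/eqP; rewrite eq_complex /=.
  by apply/andP; split; apply/eqP; ring.
move: zA; apply: (next_transitive aA (P := fun b => - (b^*)%C \in A)) => //.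
  by move=> b bA /A_opp; rewrite rmorphN.
move=> b n bA TbA nx; have [p pA E] := prev _ TbA.
(* The reflection of the successor is the predecessor of the reflection. *)
suff -> : - (n^*)%C = p by [].
apply: (mulfI mc_neq0); apply: oppr_inj; rewrite -mulNr -mulNr -E.
have := congr1 conjc (nextE _ _ bA nx); rewrite !rmorphM rmorphN /= !opprK.
by rewrite mulrN !mulNr opprK mulrN => ->.
Qed.

End Arrangement.
End Plane.

(** * Euclidean geometry of column vectors *)

Section Euclidean.
Variables (R : realType) (d : nat).
Implicit Types (x y r c u : 'cV[R]_d) (X Y : {fset 'cV[R]_d}) (T : 'M[R]_d).

Lemma dotC x y : dot x y = dot y x.
Proof. by rewrite /dot -[in LHS](trmxK y) -trmx_mul mxE. Qed.

Lemma dotDr x y z : dot x (y + z) = dot x y + dot x z.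
Proof. by rewrite /dot mulmxDr mxE. Qed.

Lemma dotNr x y : dot x (- y) = - dot x y.
Proof. by rewrite /dot mulmxN mxE. Qed.

Lemma dotBr x y z : dot x (y - z) = dot x y - dot x z.
Proof. by rewrite dotDr dotNr. Qed.

Lemma dotZr x (a : R) y : dot x (a *: y) = a * dot x y.
Proof. by rewrite /dot -scalemxAr mxE. Qed.

Lemma dotx0 x : dot x 0 = 0.
Proof. by rewrite /dot mulmx0 mxE. Qed.

Lemma dotDl x y z : dot (x + y) z = dot x z + dot y z.
Proof. by rewrite !(dotC _ z) dotDr. Qed.

Lemma dotBl x y z : dot (x - y) z = dot x z - dot y z.
Proof. by rewrite !(dotC _ z) dotBr. Qed.

Lemma dotZl x (a : R) y : dot (a *: x) y = a * dot x y.
Proof. by rewrite !(dotC _ y) dotZr. Qed.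

Lemma dot_suml (I : Type) (s : seq I) (P : pred I) (F : I -> 'cV[R]_d) y :
  dot (\sum_(i <- s | P i) F i) y = \sum_(i <- s | P i) dot (F i) y.
Proof.
apply: (big_morph (fun x => dot x y)) => [? ?|]; first exact: dotDl.
by rewrite dotC dotx0.
Qed.

Lemma dot_eq0 x : (dot x x == 0) = (x == 0).
Proof.
apply/eqP/eqP => [|->]; last exact: dotx0.
rewrite /dot mxE => /eqP; rewrite psumr_eq0; last first.
  by move=> i _; rewrite mxE -expr2 sqr_ge0.
move/allP => h; apply/colP => i; rewrite mxE.
by have := h i (mem_index_enum i); rewrite mxE -expr2 sqrf_eq0 => /eqP.
Qed.

Lemma dot_gt0 x : (0 < dot x x) = (x != 0).
Proof.
rewrite lt_neqAle eq_sym dot_eq0 /dot mxE sumr_ge0 ?andbT // => i _.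
by rewrite mxE -expr2 sqr_ge0.
Qed.

Lemma dot_orthogonal T x y : orthogonal T -> dot (T *m x) (T *m y) = dot x y.
Proof. by move=> oT; rewrite /dot trmx_mul -mulmxA (mulmxA T^T) oT mul1mx. Qed.

Lemma orthogonal_inj T : orthogonal T -> injective (mulmx T : 'cV[R]_d -> _).
Proof. by move=> oT x y /(congr1 (mulmx T^T)); rewrite !mulmxA oT !mul1mx. Qed.

Lemma reflectionE r x :
  reflection r *m x = x - (2 / dot r r * dot r x) *: r.
Proof.
rewrite /reflection mulmxBl mul1mx -scalemxAl -mulmxA; congr (_ - _).
by rewrite [r^T *m x]mx11_scalar -/(dot r x) mul_mx_scalar scalerA.
Qed.

Lemma reflectionK r x : r != 0 -> reflection r *m (reflection r *m x) = x.
Proof.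
rewrite -dot_eq0 => r0; rewrite !reflectionE dotBr dotZr -addrA -opprD -scalerDl.
set a := (X in X *: _); suff -> : a = 0 by rewrite scale0r subr0.
by rewrite /a; field.
Qed.

Lemma reflection_sym r x y :
  dot (reflection r *m x) y = dot x (reflection r *m y).
Proof.
rewrite !reflectionE dotBl dotBr dotZl dotZr (dotC r x); ring.
Qed.

Lemma reflection_orthogonal r : r != 0 -> orthogonal (reflection r).
Proof.
move=> r0; rewrite /orthogonal; apply/matrixP => i j.
have E : (reflection r)^T = reflection r.
  by rewrite /reflection linearB /= trmx1 linearZ /= trmx_mul trmxK.
rewrite E; have := reflectionK (delta_mx j 0) r0.
rewrite mulmxA -colE => /colP/(_ i); rewrite !mxE eqxx andbT => ->.
by rewrite eq_sym.
Qed.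

Lemma reflection_self r : r != 0 -> reflection r *m r = - r.
Proof.
rewrite -dot_eq0 => r0; rewrite reflectionE.
rewrite -mulrA mulVf // mulr1.
by rewrite scaler_nat mulr2n opprD addrA subrr add0r.
Qed.

Lemma orthogonal_mul T T' : orthogonal T -> orthogonal T' -> orthogonal (T *m T').
Proof.
by rewrite /orthogonal trmx_mul => oT oT'; rewrite -mulmxA (mulmxA T^T) oT mul1mx.
Qed.

Lemma mximageM T T' X : mximage (T *m T') X = mximage T (mximage T' X).
Proof.
apply/fsetP => x; apply/imfsetP/imfsetP => /= [[y yX ->]|[_ /imfsetP[y yX ->] ->]].
  by exists (T' *m y); rewrite ?mulmxA //; apply/imfsetP; exists y.
by exists y; rewrite ?mulmxA.
Qed.

Lemma mem_mximage T X x : orthogonal T -> (T *m x \in mximage T X) = (x \in X).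
Proof. by move=> oT; apply: mem_imfset; exact: orthogonal_inj. Qed.

Lemma congruent_refl X : congruent X X.
Proof.
exists 1%:M; split; first by rewrite /orthogonal trmx1 mulmx1.
apply/fsetP => x; apply/imfsetP/idP => [[y yX ->]|xX]; rewrite ?mul1mx //.
by exists x; rewrite ?mul1mx.
Qed.

Lemma congruent_trans Y X Z : congruent X Y -> congruent Y Z -> congruent X Z.
Proof.
case=> T [oT <-] [T' [oT' <-]]; exists (T' *m T); split.
  exact: orthogonal_mul.
by rewrite mximageM.
Qed.

(** * Root systems have congruent semi-stars *)

Definition positive X c := [fset x in X | 0 < dot x c].

Definition generic X c := forall x, x \in X -> dot x c != 0.

Lemma sum_mximage T X (P : pred 'cV[R]_d) : orthogonal T ->
  \sum_(x <- mximage T X | P x) x = T *m \sum_(x <- X | P (T *m x)) x.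
Proof.
move=> oT; rewrite big_mkcond big_imfset /=; last first.
  by move=> x y _ _; exact: orthogonal_inj.
by rewrite -big_mkcond mulmx_sumr.
Qed.

Lemma mximage_positive T X c : orthogonal T -> mximage T X = X ->
  mximage T (positive X c) = positive X (T *m c).
Proof.
move=> oT TX; apply/fsetP => x; rewrite !inE /= -{2}TX.
apply/imfsetP/andP => /= [[y]|[/imfsetP[y /= yX ->]]].
  rewrite !inE /= => /andP[yX y0] ->.
  by rewrite dot_orthogonal // mem_mximage.
by rewrite dot_orthogonal // => y0; exists y; rewrite // !inE /= yX.
Qed.

(** Among the semi-stars congruent to that of [c], take one, [positive X b], whose
    sum [v] has the largest projection on [c']. If some [r] in it had
    [dot r c' < 0], then reflecting at [r] would increase the projection, since
    [dot v r > 0]: indeed [positive X b] is the semi-star whose sum has the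
    largest projection on [b], and the reflection at [r] removes [r] from it. *)
Lemma congruent_positive X c c' : root_system X ->
  (forall x, x \in X -> - x \in X) -> generic X c -> generic X c' ->
  congruent (positive X c) (positive X c').
Proof.
move=> [X0 XT] X_opp gc gc'.
have X_neq0 x : x \in X -> x != 0 by move=> xX; apply: contraNneq X0 => <-.
pose S0 := positive X c.
have [|S [_ [[b [gb ->]] S0S] Smax]] := @fset_argmax _ _ (fpowerset X)
  (fun S => (exists b, generic X b /\ S = positive X b) /\ congruent S0 S)
  (fun S : {fset 'cV[R]_d} => dot (\sum_(x <- S) x) c').
  exists S0; first by rewrite fpowersetE; apply: fset_sub.
  by split; [exists c | exact: congruent_refl].
set v := \sum_(x <- _) x in Smax.
suff <- : positive X b = positive X c' by [].
have pos_sub : forall r, r \in positive X b -> 0 < dot r c'.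
  move=> r; rewrite !inE /= => /andP[rX rb].
  rewrite ltNge le_eqVlt (negPf (gc' _ rX)) /=; apply/negP => rc'.
  have oT := reflection_orthogonal (X_neq0 _ rX).
  have TX := XT _ rX.
  have gTb : generic X (reflection r *m b).
    by move=> x; rewrite -TX => /imfsetP[y /= yX ->]; rewrite dot_orthogonal // gb.
  have TS := mximage_positive b oT TX.
  have := Smax (positive X (reflection r *m b)).
  have sumT : \sum_(x <- positive X (reflection r *m b)) x = reflection r *m v.
    by rewrite -TS sum_mximage.
  rewrite sumT => Smax'.
  have {Smax'} le_v : dot (reflection r *m v) c' <= dot v c'.
    apply: Smax'; first by rewrite fpowersetE; apply: fset_sub.
    split; first by exists (reflection r *m b).
    by apply: (congruent_trans S0S); exists (reflection r); split.
  have lt_v : dot (reflection r *m v) b < dot v b.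
    (* Summand by summand over [X], strictly at [r]. *)
    rewrite -sumT /v !dot_suml !big_fset /= big_mkcond [ltRHS]big_mkcond /=.
    rewrite (big_fsetD1 r) //= [ltRHS](big_fsetD1 r) //= rb.
    rewrite -reflection_sym reflection_self ?X_neq0 // dotNl oppr_gt0.
    rewrite (le_gtF (ltW rb)) add0r ltr_pwDl //; apply: ler_sum => x _.
    by case: ifP => _; case: ltrP => // /ltW.
  have rr : 0 < dot r r by rewrite dot_gt0 X_neq0.
  move: le_v lt_v; rewrite reflectionE !dotBl !dotZl.
  rewrite gerBl gtrBl pmulr_lgt0 // => le_v k0; move: le_v.
  by rewrite pmulr_rge0 // leNgt rc'.
apply/fsetP => x; apply/idP/idP => [xb|].
  rewrite !inE /= pos_sub // andbT.
  by move: xb; rewrite !inE => /andP[].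
rewrite !inE /= => /andP[xX xc']; rewrite xX /=.
rewrite ltNge le_eqVlt (negPf (gb _ xX)) /=; apply/negP => xb.
have := pos_sub (- x); rewrite !inE /= X_opp //= dotNl oppr_gt0 xb => /(_ isT).
by rewrite dotNl oppr_gt0 ltNge ltW.
Qed.

(** * Sums over half-spaces and perturbation of their normals *)

Definition half_sum Y c := \sum_(x <- Y | 0 < dot x c) x.
Definition level X l := [fset x in X | dot x x == l].
Definition perp X c := [fset x in X | dot x c == 0].

(** For a small positive [e], the sign of a vector of [X] on [c + e *: u] is
    the first nonzero one among its signs on [c] and on [u]. *)
Definition lexicographic X c u (e : R) := forall x, x \in X ->
  (0 < dot x (c + e *: u)) = (0 < dot x c) || (dot x c == 0) && (0 < dot x u).

Lemma lexicographic_exists X c u : exists e, lexicographic X c u e.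
Proof.
pose P (Z : seq 'cV[R]_d) := exists2 e : R, 0 < e & forall e', 0 < e' -> e' <= e ->
  forall x, x \in Z ->
    (0 < dot x (c + e' *: u)) = (0 < dot x c) || (dot x c == 0) && (0 < dot x u).
suff [e e0 h] : P X by exists e => x xX; apply: (h e).
elim: (enum_fset X) => [|z Z [e e0 IH]]; first by exists 1.
have [e1 e10 h1] : exists2 e1 : R, 0 < e1 & forall e', 0 < e' -> e' <= e1 ->
    (0 < dot z (c + e' *: u)) = (0 < dot z c) || (dot z c == 0) && (0 < dot z u).
  have [d0|] := eqVneq (dot z c) 0.
    exists 1 => // e' e'0 _.
    by rewrite dotDr dotZr d0 add0r ltxx /= pmulr_rgt0.
  rewrite -normr_gt0 => d0; exists (`|dot z c| / (2 * (1 + `|dot z u|))).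
    by rewrite divr_gt0 // mulr_gt0 // ltr_pwDl.
  move=> e' e'0; rewrite ler_pdivlMr ?mulr_gt0 ?ltr_pwDl // => le_e.
  have : `|e' * dot z u| < `|dot z c|.
    rewrite normrM (gtr0_norm e'0).
    have := mulr_ge0 (ltW e'0) (normr_ge0 (dot z u)); nra.
  rewrite dotDr dotZr orbF ltr_norml.
  case: (ltrgtP (dot z c) 0) d0 => [s _|s _|->]; last by rewrite normr0 ltxx.
    rewrite (ltr0_norm s) => /andP[_ h]; apply/negbTE; rewrite -leNgt; lra.
  by rewrite (gtr0_norm s) => /andP[h _]; lra.
exists (Num.min e e1); first by rewrite lt_min e0.
move=> e' e'0; rewrite le_min => /andP[le_e le_e1] x.
by rewrite inE => /orP[/eqP->|xZ]; [apply: h1 | apply: IH].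
Qed.


Lemma half_sum_lexicographic X Y c u e : Y `<=` X -> lexicographic X c u e ->
  half_sum Y (c + e *: u) = half_sum Y c + half_sum (perp Y c) u.
Proof.
move=> /fsubsetP YX h.
have -> : half_sum (perp Y c) u =
    \sum_(x <- Y | (dot x c == 0) && (0 < dot x u)) x.
  by rewrite /half_sum big_mkcond big_fset /= -big_mkcondr.
rewrite /half_sum [LHS]big_mkcond [\sum_(x <- Y | 0 < dot x c) _]big_mkcond.
rewrite [\sum_(x <- Y | _ && _) _]big_mkcond.
rewrite -big_split /=; apply: eq_big_seq => x xY; rewrite h ?YX //.
by case: ltrgtP => _ /=; rewrite ?addr0 ?add0r.
Qed.

Lemma lexicographic_eq0 X c u e : (forall x, x \in X -> - x \in X) ->
  lexicographic X c u e ->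
  forall x, x \in X -> dot x (c + e *: u) = 0 -> dot x c = 0 /\ dot x u = 0.
Proof.
move=> X_opp h x xX d0; have := h _ xX; have := h _ (X_opp _ xX).
rewrite !(dotNl x) d0 oppr0 ltxx !oppr_gt0 oppr_eq0.
by case: (ltrgtP (dot x c) 0) => // -> /=; case: (ltrgtP (dot x u) 0).
Qed.

Lemma half_sumN Y u : (forall x, x \in Y -> - x \in Y) ->
  half_sum Y (- u) = - half_sum Y u.
Proof.
move=> Y_opp; rewrite /half_sum -sum_fset_opp //; apply: eq_bigl => x.
by rewrite dotNl dotNr.
Qed.

Lemma dotNN x : dot (- x) (- x) = dot x x.
Proof. by rewrite dotNl dotNr opprK. Qed.

Lemma perp_opp Y c : (forall x, x \in Y -> - x \in Y) ->
  forall x, x \in perp Y c -> - x \in perp Y c.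
Proof.
by move=> Yopp x; rewrite !inE /= => /andP[/Yopp-> ]; rewrite dotNl oppr_eq0.
Qed.

(** A vector space over an infinite field is not a finite union of proper
    subspaces: a normal that misses [z] is corrected by a small multiple of one
    that does not. *)
Lemma avoid_hyperplanes (U : 'cV[R]_d -> Prop) X : U 0 ->
  (forall c c' e, U c -> U c' -> U (c + e *: c')) ->
  (forall x, x \in X -> exists2 c, U c & dot x c != 0) ->
  exists2 c, U c & generic X c.
Proof.
move=> U0 Ulin; pose P (s : seq 'cV[R]_d) :=
  (forall x, x \in s -> exists2 c, U c & dot x c != 0) ->
  exists2 c, U c & forall x, x \in s -> dot x c != 0.
suff : P X by [].
elim: (enum_fset X) => [|z s IH] zs; first by exists 0.
have [x xs|c Uc gc] := IH; first by apply: zs; rewrite inE xs orbT.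
have [c' Uc' zc'] := zs z (mem_head _ _).
pose Y := [fset x in z :: s] `|` [fset - x | x in z :: s].
have Y_opp x : x \in Y -> - x \in Y.
  case/fsetUP => [|/imfsetP[y /= ys ->]].
    by rewrite in_fset => xs; apply/fsetUP; right; apply/imfsetP; exists x.
  by rewrite opprK; apply/fsetUP; left; rewrite in_fset.
have [e h] := lexicographic_exists Y c c'.
exists (c + e *: c') => [|x xzs]; first exact: Ulin.
have xY : x \in Y by apply/fsetUP; left; rewrite in_fset.
apply/eqP => /(lexicographic_eq0 Y_opp h xY)[xc xc'].
move: xzs; rewrite inE => /orP[/eqP xz|/gc]; last by rewrite xc eqxx.
by rewrite -xz xc' eqxx in zc'.
Qed.

(** * Balance conditions imposed by congruent semi-stars *)

Section SemiStars.
Variable X : {fset 'cV[R]_d}.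
Hypothesis X_neq0 : 0 \notin X.
Hypothesis X_opp : forall x, x \in X -> - x \in X.
Hypothesis X_congruent : forall S S', semi_star X S -> semi_star X S' ->
  congruent S S'.

(** An orthogonal map between two semi-stars preserves lengths, so it also maps
    their subsets of elements of a given length, hence the sums of these. *)
Lemma half_sum_invariant l m c c' : generic X c -> generic X c' ->
  dot (half_sum (level X l) c) (half_sum (level X m) c) =
  dot (half_sum (level X l) c') (half_sum (level X m) c').
Proof.
have [->|[r rX]] := fset_0Vmem X.
  move=> _ _; suff E k b : half_sum (level fset0 k) b = 0 by rewrite !E.
  by rewrite /half_sum big1_seq // => x; rewrite !inE andbF.
have star b : generic X b -> semi_star X (positive X b).
  move=> gb; apply/(semi_starP _ X_opp); exists b; split=> //.
  by apply: contraNneq (gb r rX) => ->; rewrite dotx0.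
move=> /star Sc /star Sc'; have [T [oT TS]] := X_congruent Sc Sc'.
have sumE k b : half_sum (level X k) b = \sum_(x <- positive X b | dot x x == k) x.
  rewrite /half_sum [LHS]big_mkcond big_fset -big_mkcondr /=.
  rewrite [RHS]big_mkcond big_fset -big_mkcondr /=.
  by apply: eq_bigl => x; rewrite andbC.
rewrite !sumE -TS !sum_mximage // dot_orthogonal //.
congr dot; apply: eq_bigl => x; rewrite dot_orthogonal //.
Qed.

Lemma level_sub l : level X l `<=` X.
Proof. by apply/fsubsetP => x; rewrite !inE => /andP[]. Qed.

Lemma level_opp l x : x \in level X l -> - x \in level X l.
Proof. by rewrite !inE /= dotNN => /andP[/X_opp-> ->]. Qed.

(** Tilting [c] towards [r] or towards [- r] gives two semi-stars that differ in
    the sign of [r] only. Let [w_k] be the sum over the elements of squared length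
    [k] on the positive side of [c], and let [e_k] be [r] if [k = dot r r] and 0
    otherwise. Invariance of the products of [w_k + e_k] and [w_m + e_m] under
    the sign change of [r] gives [dot w_k e_m + dot e_k w_m = 0]. Taking
    [k = m = dot r r] settles that length, and then [m = dot r r] all others. *)
Lemma wall_balanced r c l : r \in X -> dot r c = 0 ->
  (forall x, x \in X -> dot x c = 0 -> x = r \/ x = - r) ->
  dot (half_sum (level X l) c) r = 0.
Proof.
move=> rX rc0 c_wall.
have r0 : dot r r != 0 by rewrite dot_eq0; apply: contraNneq X_neq0 => <-.
have [e1 h1] := lexicographic_exists X c r.
have [e2 h2] := lexicographic_exists X c (- r).
have g1 : generic X (c + e1 *: r).
  move=> x xX; apply/eqP => /(lexicographic_eq0 X_opp h1 xX)[/(c_wall _ xX)[]-> /eqP].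
    exact/negP.
  by rewrite dotNl oppr_eq0; apply/negP.
have g2 : generic X (c + e2 *: - r).
  move=> x xX; apply/eqP => /(lexicographic_eq0 X_opp h2 xX)[/(c_wall _ xX)[]-> /eqP].
    by rewrite dotNr oppr_eq0; apply/negP.
  by rewrite dotNN; apply/negP.
have r_gt0 : 0 < dot r r by rewrite dot_gt0 -dot_eq0.
pose e k := half_sum (perp (level X k) c) r.
have eE k : e k = if k == dot r r then r else 0.
  rewrite /e /half_sum; case: eqP => [->|kr]; last first.
    rewrite big1_seq // => x; rewrite !inE /= -andbA => /and4P[_ xX /eqP xk /eqP].
    by case/(c_wall _ xX) => xE; case: kr; rewrite -xk xE ?dotNN.
  rewrite big_mkcond /= (big_fsetD1 r) /=; last by rewrite !inE /= rX rc0 !eqxx.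
  rewrite r_gt0 big1_seq ?addr0 // => x.
  rewrite !inE /= -!andbA => /and4P[xr xX _ /eqP /(c_wall _ xX)[xE|->]].
    by rewrite xE eqxx in xr.
  by rewrite dotNl oppr_gt0 (le_gtF (ltW r_gt0)).
have inv k m := half_sum_invariant k m g1 g2.
have eN k : half_sum (perp (level X k) c) (- r) = - e k.
  by rewrite half_sumN //; apply: perp_opp; exact: level_opp.
have {}inv k m : dot (half_sum (level X k) c) (e m) + dot (e k) (half_sum (level X m) c) = 0.
  have := inv k m.
  rewrite !(half_sum_lexicographic (level_sub _) h1) !(half_sum_lexicographic (level_sub _) h2).
  rewrite !eN !(dotDl, dotDr, dotNl, dotNr); lra.
have mm : dot (half_sum (level X (dot r r)) c) r = 0.
  have := inv (dot r r) (dot r r); rewrite eE eqxx (dotC r); lra.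
have := inv l (dot r r); rewrite !eE eqxx; case: ifP => _.
  by rewrite [dot r _]dotC mm addr0.
by rewrite [dot 0 _]dotC dotx0 addr0.
Qed.

(** The difference of the two conditions of [wall_balanced] at normals obtained by
    tilting [c] towards [u] and towards [- u]: the elements off the
    hyperplane of [c] cancel. In this way the condition descends to the part of
    [X] in a subspace. *)
Lemma flat_balanced r c u l : r \in X -> dot r c = 0 -> dot r u = 0 ->
  (forall x, x \in X -> dot x c = 0 -> dot x u = 0 -> x = r \/ x = - r) ->
  dot (half_sum (perp (level X l) c) u) r = 0.
Proof.
move=> rX rc ru cu_wall.
have [e1 h1] := lexicographic_exists X c u.
have [e2 h2] := lexicographic_exists X c (- u).
have := @wall_balanced r (c + e1 *: u) l rX.
rewrite dotDr dotZr rc ru mulr0 addr0 => /(_ erefl) b1.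
have {}b1 := b1 (fun x xX d0 => let: conj xc xu := lexicographic_eq0 X_opp h1 xX d0 in
  cu_wall x xX xc xu).
have := @wall_balanced r (c + e2 *: - u) l rX.
rewrite dotDr dotZr dotNr rc ru oppr0 mulr0 addr0 => /(_ erefl) b2.
have {}b2 : dot (half_sum (level X l) (c + e2 *: - u)) r = 0.
  apply: b2 => x xX /(lexicographic_eq0 X_opp h2 xX)[xc /eqP].
  by rewrite dotNr oppr_eq0 => /eqP; apply: cu_wall.
move: b1 b2; rewrite (half_sum_lexicographic (level_sub _) h1).
rewrite (half_sum_lexicographic (level_sub _) h2) half_sumN; last first.
  by apply: perp_opp; exact: level_opp.
rewrite !dotDl dotNl; lra.
Qed.

End SemiStars.

End Euclidean.

(** * Transfer to a plane spanned by two vectors *)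

Section Planes.
Variables (R : realType) (d : nat).
Implicit Types (x y r c u s : 'cV[R]_d) (T : 'M[R]_d).
Variables e1 e2 : 'cV[R]_d.
Hypothesis e11 : dot e1 e1 = 1.
Hypothesis e22 : dot e2 e2 = 1.
Hypothesis e12 : dot e1 e2 = 0.

Definition plane_coord x : R[i] := (dot x e1 +i* dot x e2)%C.

Definition plane_point (z : R[i]) := complex.Re z *: e1 + complex.Im z *: e2.

Definition quarter_turn x := dot x e1 *: e2 - dot x e2 *: e1.

Lemma plane_pointK : cancel plane_point plane_coord.
Proof.
have e21 : dot e2 e1 = 0 by rewrite dotC.
case=> a b; rewrite /plane_coord /plane_point /= !dotDl !dotZl.
by rewrite e11 e22 e12 e21 !mulr0 !mulr1 addr0 add0r.
Qed.

Lemma plane_coord_sum (I : Type) (s : seq I) (P : pred I) (F : I -> 'cV[R]_d) :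
  plane_coord (\sum_(i <- s | P i) F i) = \sum_(i <- s | P i) plane_coord (F i).
Proof.
apply: (big_morph plane_coord) => [x y|]; rewrite /plane_coord.
  by rewrite !dotDl.
by rewrite !(dotC 0) !dotx0.
Qed.

Lemma cdot_plane x y : plane_point (plane_coord x) = x ->
  cdot (plane_coord x) (plane_coord y) = dot y x.
Proof.
by move=> xE; rewrite -[in RHS]xE /cdot /= dotDr !dotZr.
Qed.

Lemma cdet_plane x y :
  cdet (plane_coord x) (plane_coord y) = dot y (quarter_turn x).
Proof. by rewrite /cdet /= dotBr !dotZr. Qed.

Variable X : {fset 'cV[R]_d}.
Hypothesis X_neq0 : 0 \notin X.
Hypothesis X_opp : forall x, x \in X -> - x \in X.
Hypothesis X_line : forall r x k, r \in X -> x \in X -> x = k *: r -> x = r \/ x = - r.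
Hypothesis X_congruent : forall S S', semi_star X S -> semi_star X S' ->
  congruent S S'.

Lemma plane_normal : exists c, [/\ dot e1 c = 0, dot e2 c = 0 &
  forall x, x \in X -> dot x c = 0 -> plane_point (plane_coord x) = x].
Proof.
have [||x|c [c1 c2] gc] := @avoid_hyperplanes _ _
    (fun c => dot e1 c = 0 /\ dot e2 c = 0)
    [fset x in X | plane_point (plane_coord x) != x].
- by rewrite !dotx0.
- by move=> c c' e [c1 c2] [c1' c2']; rewrite !dotDr !dotZr c1 c2 c1' c2' mulr0 addr0.
(* The component of [x] orthogonal to the plane. *)
- rewrite !inE /= => /andP[_ xP]; pose n := x - plane_point (plane_coord x).
  have n0 : n != 0 by rewrite subr_eq0 eq_sym.
  have := plane_pointK (plane_coord x).
  rewrite {1}/plane_coord => -[E1 E2].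
  have n1 : dot e1 n = 0 by rewrite dotC dotBl E1 subrr.
  have n2 : dot e2 n = 0 by rewrite dotC dotBl E2 subrr.
  exists n => //; have -> : dot x n = dot n n.
    by rewrite [in RHS]/n dotBl dotDl !dotZl n1 n2 !mulr0 addr0 subr0.
  by rewrite dot_eq0.
exists c; split=> // x xX xc; apply/eqP; apply: contraTT isT => xP.
by have := gc x; rewrite !inE /= xX xP xc eqxx => /(_ isT).
Qed.

(** The elements of [X] in the plane with the length of [s] form a set [A] of complex
    numbers. By [flat_balanced] it is balanced at the direction of every element
    of [X] in the plane: at those of [A] itself, and at the real axis, which carries
    an element of [X] that may have another length. Thus [conj_opp_stable]
    applies; it is the reflection of the plane in the first coordinate. *)
Lemma plane_reflection a s : a != 0 -> a *: e1 \in X -> s \in X ->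
  plane_point (plane_coord s) = s ->
  plane_point (- ((plane_coord s)^*)%C) \in X.
Proof.
move=> a0 rX sX sP; have [c [c1 c2 cP]] := plane_normal.
have inP x : plane_point (plane_coord x) = x -> dot x c = 0.
  by move=> <-; rewrite dotDl !dotZl c1 c2 !mulr0 addr0.
have l_gt0 : 0 < dot s s by rewrite dot_gt0; apply: contraNneq X_neq0 => <-.
pose Y := perp (level X (dot s s)) c.
have YX x : x \in Y -> x \in X by rewrite !inE /= -andbA => /andP[].
have YP x : x \in Y -> plane_point (plane_coord x) = x.
  by move=> xY; apply: cP; [exact: YX | move: xY; rewrite inE /= => /andP[_ /eqP]].
have Y_opp x : x \in Y -> - x \in Y by apply: perp_opp; exact: level_opp.
pose A := [fset plane_coord x | x in Y].
have aboveE z u : (forall x, cdet z (plane_coord x) = dot x u) ->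
    above A z = plane_coord (half_sum Y u).
  move=> zu; rewrite /above big_mkcond big_imfset /=; last first.
    by move=> x y xY yY /(congr1 plane_point); rewrite !YP.
  by rewrite -big_mkcond plane_coord_sum; apply: eq_bigl => x; rewrite zu.
have balanced r u : r \in X -> dot r c = 0 -> dot r u = 0 ->
    (forall x, x \in X -> plane_point (plane_coord x) = x -> dot x u = 0 ->
      exists k, x = k *: r) -> dot (half_sum Y u) r = 0.
  move=> rX' rc ru line; apply: (flat_balanced X_neq0 X_opp X_congruent) => //.
  by move=> x xX /(cP _ xX) xP /(line _ xX xP)[k]; apply: X_line.
have A_norm z : z \in A -> cdot z z = dot s s.
  case/imfsetP => x /= xY ->; rewrite cdot_plane ?YP //.
  by move: xY; rewrite !inE /= => /andP[/andP[_ /eqP]].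
have A_opp z : z \in A -> - z \in A.
  case/imfsetP => x /= xY ->; apply/imfsetP; exists (- x); first exact: Y_opp.
  by rewrite /plane_coord !dotNl.
have A_bal z : z \in A -> cdot z (above A z) = 0.
  case/imfsetP => b /= bY ->; rewrite (aboveE _ (quarter_turn b)); last first.
    by move=> x; rewrite cdet_plane.
  rewrite cdot_plane ?YP //; apply: balanced; first exact: YX.
  - by apply: inP; exact: YP.
  - by rewrite -cdet_plane cdetxx.
  move=> x xX xP; rewrite -cdet_plane => d0.
  exists (dot x b / dot b b).
  have b0 : dot b b != 0.
    by rewrite dot_eq0; apply: contraNneq X_neq0 => <-; exact: YX.
  have := cdot_cdetK (plane_coord b) (plane_coord x).
  rewrite d0 !cdot_plane ?YP // => -[].
  rewrite !mul0r !subr0 !addr0 => E1 E2.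
  rewrite -[LHS]xP -[X in _ = _ *: X](YP _ bY) /plane_point scalerDr !scalerA /=.
  by congr (_ *: _ + _ *: _); rewrite mulrAC ?E1 ?E2 mulrC mulKf.
have A_bal1 : complex.Re (above A 1) = 0.
  rewrite (aboveE _ e2) => [|x]; last by rewrite /cdet /= mul1r mul0r subr0.
  apply: (mulfI a0); rewrite mulr0 /= -dotZr; apply: balanced => //.
  - by rewrite dotZl c1 mulr0.
  - by rewrite dotZl e12 mulr0.
  move=> x xX xP x2; exists (dot x e1 / a).
  by rewrite scalerA divfK // -[in LHS]xP /plane_point /= x2 scale0r addr0.
have sA : plane_coord s \in A.
  by apply/imfsetP; exists s => //=; rewrite !inE /= sX eqxx inP ?eqxx.
have := conj_opp_stable l_gt0 A_norm A_opp A_bal A_bal1 sA.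
by case/imfsetP => x /= xY ->; rewrite YP // YX.
Qed.

End Planes.

(** * The equivalence *)

Section Main.
Variables (R : realType) (d : nat) (X : {fset 'cV[R]_d}).
Hypothesis X_neq0 : 0 \notin X.
Hypothesis X_reduced : reduced X.

Lemma reduced_line r x k : r \in X -> x \in X -> x = k *: r -> x = r \/ x = - r.
Proof.
move=> rX xX xE; have : x \in [fset x in X | x \in <[r]>%VS].
  by rewrite !inE /= xX xE memvZ // memv_line.
by rewrite X_reduced // !inE => /orP[]/eqP; [right|left].
Qed.

Lemma reduced_opp x : x \in X -> - x \in X.
Proof.
move=> xX; have : - x \in [fset - x; x] by rewrite !inE eqxx.
by rewrite -(X_reduced xX) inE /= => /andP[].
Qed.

(** Two elements [r] and [s] that are not parallel span a plane, in which
    [plane_reflection] applies with the first axis along [r]. *)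
Lemma congruent_root_system :
  (forall S S', semi_star X S -> semi_star X S' -> congruent S S') ->
  root_system X.
Proof.
move=> X_congruent; split=> // r rX.
have r0 : r != 0 by apply: contraNneq X_neq0 => <-.
have oT := reflection_orthogonal r0.
suff sub : mximage (reflection r) X `<=` X.
  apply/eqP; rewrite eqEfcard sub card_imfset //=; exact: orthogonal_inj.
apply/fsubsetP => _ /imfsetP[s /= sX ->].
have rr : dot r r != 0 by rewrite dot_eq0.
pose u := s - (dot r s / dot r r) *: r.
have ru : dot r u = 0 by rewrite dotBr dotZr divfK // subrr.
have sE : s = u + (dot r s / dot r r) *: r by rewrite subrK.
have [u0|u_neq0] := eqVneq u 0.
  move: sE; rewrite u0 add0r => /(reduced_line rX sX)[]->.
    by rewrite reflection_self // reduced_opp.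
  by rewrite mulmxN reflection_self // opprK.
have nrm (v : 'cV[R]_d) : v != 0 ->
    exists2 a : R, a != 0 & dot (a^-1 *: v) (a^-1 *: v) = 1.
  rewrite -dot_gt0 => v0; exists (Num.sqrt (dot v v)).
    by rewrite gt_eqF // sqrtr_gt0.
  by rewrite dotZl dotZr mulrA -expr2 exprVn sqr_sqrtr ?ltW // mulVf // gt_eqF.
have [a a0 e11] := nrm _ r0; have [b b0 e22] := nrm _ u_neq0.
set e1 := _ *: r in e11; set e2 := _ *: u in e22.
have e12 : dot e1 e2 = 0 by rewrite dotZl dotZr ru !mulr0.
have rE : r = a *: e1 by rewrite scalerA divff // scale1r.
have uE : u = b *: e2 by rewrite scalerA divff // scale1r.
have sP : plane_point e1 e2 (plane_coord e1 e2 s) = s.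
  have -> : s = plane_point e1 e2 (dot r s / dot r r * a +i* b)%C.
    by rewrite /plane_point /= -scalerA -rE -uE addrC.
  by rewrite plane_pointK.
have rX' : a *: e1 \in X by rewrite -rE.
have := plane_reflection e11 e22 e12 X_neq0 reduced_opp reduced_line X_congruent
  a0 rX' sX sP.
suff -> : plane_point e1 e2 (- ((plane_coord e1 e2 s)^*)%C) = reflection r *m s by [].
have Te1 : reflection r *m e1 = - e1.
  by rewrite -scalemxAr reflection_self // scalerN.
have Te2 : reflection r *m e2 = e2.
  by rewrite reflectionE dotZr ru !mulr0 scale0r subr0.
clearbody e1 e2; rewrite -[in RHS]sP /plane_point mulmxDr -!scalemxAr Te1 Te2.
by rewrite /= opprK scalerN scaleNr.
Qed.

Lemma root_system_congruent S S' : root_system X ->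
  semi_star X S -> semi_star X S' -> congruent S S'.
Proof.
move=> rs /(semi_starP _ reduced_opp)[c [_ gc ->]].
move=> /(semi_starP _ reduced_opp)[c' [_ gc' ->]].
by apply: congruent_positive => //; exact: reduced_opp.
Qed.

End Main.

Theorem corollary5p1 (R : realType) (d : nat) (X : {fset 'cV[R]_d})
    (X_neq0 : 0 \notin X) (X_reduced : reduced X) :
  root_system X <->
  (forall S S' : {fset 'cV[R]_d},
     semi_star X S -> semi_star X S' -> congruent S S').
Proof.
split=> [X_root S S'|]; first exact: root_system_congruent.
exact: congruent_root_system.
Qed.
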